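(* Let $k=2$, let $(X_1,X_2)$ and the family $\{P_\theta:\theta=(\theta_1,\theta_2)\in\mathbf{R}^2\}$ satisfy the distributional and monotonicity assumptions in the context, let $\alpha\in(0,1)$ and $\varepsilon=(\varepsilon_1,\varepsilon_2)$ with $\varepsilon_1,\varepsilon_2>0$. Consider testing $H_1:\theta_1\le 0$ and $H_2:\theta_2\le 0$, and let $\mathcal{C}$ be the class of decision rules that are monotone and satisfy $\mathrm{FWER}\le\alpha$. (i) A rule $D\in\mathcal{C}$ maximizes, among rules in $\mathcal{C}$, $$\inf_{\theta\in A_1(\varepsilon)}P_\theta\{d_{0,0}^c\}\qquad(\ast)$$ if $$d_{0,0}^c=\{X_1>a_1\text{ or }X_2>a_2\}\qquad(\ast\ast)$$ and $\{X_i>a_i\}\subset d_i$ for $i=1,2$, where $a_1$ and $a_2$ are determined so that $$P_{0,0}\{X_1>a_1\text{ or }X_2>a_2\}=\alpha\quad\text{and}\quad P_{\varepsilon_1}\{X_1>a_1\}=P_{\varepsilon_2}\{X_2>a_2\}.$$ Its minimum (rejection) probability over $A_1(\varepsilon)$, i.e. its value of $(\ast)$, is $P_{\varepsilon_1}\{X_1>a_1\}$. (ii) The (stepdown) rule $D\in\mathcal{C}$ satisfying $(\ast\ast)$ that maximizes, among rules in $\mathcal{C}$ satisfying $(\ast\ast)$, $$\inf_{\theta\in A_2(\varepsilon)}P_\theta\{d_{1,1}\}$$ is given by $$d_{0,1}=\{X_1<b_1,\,X_2>a_2\},\qquad d_{1,0}=\{X_1>a_1,\,X_2<b_2\},\qquad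 d_{1,1}=\{X_1\ge b_1,\,X_2\ge b_2\}\cap d_{0,0}^c,$$ where $b_i$ satisfies $P_0\{X_i\ge b_i\}=\alpha$ (and so $b_i<a_i$), $i=1,2$. The minimum probability of $d_{1,1}$ over $A_2(\varepsilon)$ is $$P_{\varepsilon_1,\varepsilon_2}\bigl(\{X_1>a_1,X_2>b_2\}\cup\{X_1>b_1,X_2>a_2\}\bigr).$$ (iii) The result (i) holds for $D$ if the criterion $(\ast)$ is replaced by $$\inf_{\theta\in A_1(\varepsilon)}P_\theta\{\text{reject at least one false hypothesis}\},$$ and the common value $P_{\varepsilon_1}\{X_1>a_1\}=P_{\varepsilon_2}\{X_2>a_2\}$ is also the maximum value of this criterion.
   Context: Standing assumptions. $X=(X_1,\dots,X_k)$ takes values in $\mathbf{R}^k$ and has distribution $P_\theta$ indexed by $\theta=(\theta_1,\dots,\theta_k)\in\mathbf{R}^k$. The null hypothesis $H_i$ is $\theta_i\le 0$, tested against $\theta_i>0$; $H_i$ is called true at $\theta$ if $\theta_i\le0$ and false otherwise. All sets and rules are assumed measurable. (a) The distribution of any subcollection $\{X_i:i\in I\}$ depends only on $\{\theta_i:i\in I\}$; $X_i\to-\infty$ in probability as $\theta_i\to-\infty$ and $X_i\to+\infty$ in probability as $\theta_i\to+\infty$. Subscripts on $P$ list only the relevant parameters, e.g. $P_{\varepsilon_1}\{X_1>a_1\}$ refers to the marginal of $X_1$ with $\theta_1=\varepsilon_1$, and $P_0\{X_i\ge b\}$ to that of $X_i$ with $\theta_i=0$. (b) For each $\theta$, $X$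 has a joint density with respect to Lebesgue measure that is positive on $\mathbf{R}^k$. (c) Monotonicity. A set $\mathcal{M}\subset\mathbf{R}^k$ is monotone increasing if $x\in\mathcal{M}$ and $x_i\le y_i$ for all $i$ imply $y\in\mathcal{M}$. For every $\delta\in\{-1,1\}^k$, every monotone increasing $\mathcal{M}$, and all $\theta,\gamma$ with $\delta_i\theta_i\le\delta_i\gamma_i$ for all $i$, $P_\theta\{(\delta_1X_1,\dots,\delta_kX_k)\in\mathcal{M}\}\le P_\gamma\{(\delta_1X_1,\dots,\delta_kX_k)\in\mathcal{M}\}$. Decision rules. A decision rule assigns to each $x\in\mathbf{R}^k$ a set $I_x\subset\{1,\dots,k\}$ of indices $i$ for which $H_i$ is rejected. It is monotone if $x_i\le y_i$ for all $i\in I_x$ and $y_i<x_i$ for all $i\notin I_x$ imply $I_y=I_x$. $\mathrm{FWER}\le\alpha$ (strong control of the familywise error rate) means that for every $\theta$, $P_\theta\{\text{some true } H_i\text{ is rejected}\}\le\alpha$. For $k=2$, a rule $D$ partitions the sample space into $d_{0,0}$ (reject neither), $d_{0,1}$ (reject only $H_2$), $d_{1,0}$ (reject only $H_1$), $d_{1,1}$ (reject both); $d_1=d_{1,0}\cup d_{1,1}$ and $d_2=d_{0,1}\cup d_{1,1}$ are the regions where $H_1$, respectively $H_2$, is rejected. $A_1(\varepsilon)=\{\theta:\theta_1>\varepsilon_1\}\cup\{\theta:\theta_2>\varepsilon_2\}$ and $A_2(\varepsilon)=\{\theta:\theta_1>\varepsilon_1\}\cap\{\theta:\theta_2>\vare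psilon_2\}$.
   Formalization: The formal theorem adds that for each i and c, P_t{X_i>c} is right-continuous in t at ε_i (without it the infima over the strict sets A_1, A_2 can exceed the stated values), and in (ii) the maximizing rule is unique only up to a Lebesgue-null set. *)

(* Defs.v *)
From mathcomp Require Import all_boot all_order all_algebra.
From mathcomp Require Import all_classical all_reals all_analysis.
Import Order.TTheory GRing.Theory Num.Theory numFieldNormedType.Exports.

Set Implicit Arguments.
Unset Strict Implicit.
Unset Printing Implicit Defensive.

Local Open Scope classical_set_scope.
Local Open Scope ring_scope.

(* Indices are the elements ord0 (for H_1) and ord_max (for H_2) of 'I_2.     *)
Definition component (T : Type) (i : 'I_2) (x : T * T) : T :=
  if i == ord0 then x.1 else x.2.

Section Model.
Context {R : realType}.
Implicit Types (P : R * R -> probability (R * R)%type R) (theta gamma : R * R).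

(* P theta is the law of X = (X_1, X_2), so that X is the identity map and    *)
(* an event {X \in A} is the set A itself.                                    *)

(* The law of X_i when theta_i = t. Under [marginals_depend_on_own] the value *)
(* given to the other parameter is irrelevant; t is used for both.            *)
Definition marginal P (i : 'I_2) (t : R) (A : set R) : \bar R :=
  P (t, t) (component i @^-1` A).

(* For k = 2 the singletons are the only nontrivial subcollections.           *)
Definition marginals_depend_on_own P : Prop :=
  forall (i : 'I_2) theta gamma, component i theta = component i gamma ->
  forall A : set R, measurable A ->
    P theta (component i @^-1` A) = P gamma (component i @^-1` A).

Definition marginals_diverge P : Prop :=
  forall (i : 'I_2) (c : R),
    (marginal P i t [set u | u < c] @[t --> -oo%R] --> 1%E) /\
    (marginal P i t [set u | c < u] @[t --> +oo%R] --> 1%E).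

Definition positive_densities P : Prop :=
  forall theta, exists f : R * R -> R,
    [/\ measurable_fun setT f,
        forall x, 0 < f x
      & forall A : set (R * R), measurable A ->
          P theta A =
          (\int[lebesgue_measure \x lebesgue_measure]_(x in A) (f x)%:E)%E].

Definition monotone_increasing (M : set (R * R)) : Prop :=
  forall x y, M x -> (forall i, component i x <= component i y) -> M y.

Definition sign_vector (delta : R * R) : Prop :=
  forall i, component i delta = 1 \/ component i delta = -1.

Definition monotone_family P : Prop :=
  forall delta, sign_vector delta ->
  forall M : set (R * R), measurable M -> monotone_increasing M ->
  forall theta gamma,
    (forall i, component i delta * component i theta
                 <= component i delta * component i gamma) ->
    (P theta [set x | M (delta.1 * x.1, delta.2 * x.2)%R]
      <= P gamma [set x | M (delta.1 * x.1, delta.2 * x.2)%R])%E.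

(* A_1(eps) and A_2(eps) are defined by strict inequalities, and the other    *)
(* assumptions allow the law of X_i to jump in theta_i: without this          *)
(* continuity the infimum over theta_i > eps_i can exceed the value at eps_i. *)
Definition marginals_right_continuous_at P (eps : R * R) : Prop :=
  forall (i : 'I_2) (c : R),
    marginal P i t [set u | c < u] @[t --> (component i eps)^'+]
      --> marginal P i (component i eps) [set u | c < u].

(* D x is the set I_x of the indices of the rejected hypotheses.              *)
Definition rule := R * R -> {set 'I_2}.
Implicit Type D : rule.

Definition rejects D (i : 'I_2) : set (R * R) := [set x | i \in D x].

(* region D u v is d_{u,v}, with true for 1 and false for 0.                  *)
Definition region D (u v : bool) : set (R * R) :=
  [set x | (ord0 \in D x) = u /\ (ord_max \in D x) = v].

Definition measurable_rule D : Prop := forall i, measurable (rejects D i).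

Definition monotone_rule D : Prop :=
  forall x y,
    (forall i, i \in D x -> component i x <= component i y) ->
    (forall i, i \notin D x -> component i y < component i x) -> D y = D x.

Definition true_hyp theta (i : 'I_2) : Prop := component i theta <= 0.

Definition FWER_le P (alpha : R) D : Prop :=
  forall theta,
    (P theta [set x | exists2 i, true_hyp theta i & i \in D x] <= alpha%:E)%E.

Definition ruleC P (alpha : R) : set rule :=
  [set D | [/\ measurable_rule D, monotone_rule D & FWER_le P alpha D]].

Definition A1 (eps : R * R) : set (R * R) :=
  [set theta | eps.1 < theta.1] `|` [set theta | eps.2 < theta.2].

Definition A2 (eps : R * R) : set (R * R) :=
  [set theta | eps.1 < theta.1] `&` [set theta | eps.2 < theta.2].

Definition inf_reject_any P eps D : \bar R :=
  ereal_inf [set P theta (~` region D false false) | theta in A1 eps].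

Definition inf_reject_both P eps D : \bar R :=
  ereal_inf [set P theta (region D true true) | theta in A2 eps].

Definition inf_reject_false P eps D : \bar R :=
  ereal_inf [set P theta [set x | exists2 i, ~ true_hyp theta i & i \in D x]
            | theta in A1 eps].

Definition maximizes (K : set rule) (crit : rule -> \bar R) D : Prop :=
  K D /\ forall D', K D' -> (crit D' <= crit D)%E.

Definition exceeds_some (a : R * R) : set (R * R) :=
  [set x | a.1 < x.1 \/ a.2 < x.2].

Definition first_thresholds P (alpha : R) (eps a : R * R) : Prop :=
  P (0, 0) (exceeds_some a) = alpha%:E /\
  marginal P ord0 eps.1 [set u | a.1 < u] =
  marginal P ord_max eps.2 [set u | a.2 < u].

Definition second_thresholds P (alpha : R) (b : R * R) : Prop :=
  forall i, marginal P i 0 [set u | component i b <= u] = alpha%:E.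

Definition rejects_any_iff_exceeds (a : R * R) : set rule :=
  [set D | ~` region D false false = exceeds_some a].

Definition stepdown (a b : R * R) D : Prop :=
  [/\ region D false true = [set x | x.1 < b.1 /\ a.2 < x.2],
      region D true false = [set x | a.1 < x.1 /\ x.2 < b.2]
    & region D true true =
      [set x | b.1 <= x.1 /\ b.2 <= x.2] `&` ~` region D false false].

End Model.

(* Main.v *)
(* A monotone rule rejects something on a set R which is, up to strictness, an
   upper set. Sending theta_2 to -oo shows that beating P_{eps_1}(X_1 > a_1)
   over A_1(eps) forces R to contain a ray {(c_1, t) : t real} with c_1 < a_1,
   and likewise in the other coordinate; then R contains
   {X_1 > c_1 or X_2 > c_2}, whose probability at (0, 0) exceeds alpha.
   For (ii), if a rule rejects both hypotheses at x it does so on the quadrant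
   above x, and the FWER bound at theta_i = 0, with the other parameter sent to
   +oo, forces b_i <= x_i; so the stepdown rule has the largest possible
   d_{1,1}. A rule with the same minimum power cannot miss an interior point of
   that set, because it would then miss a rectangle, whose probability converges
   as theta decreases to eps. *)
Require Import Defs.
From HB Require Import structures.
From mathcomp Require Import all_boot all_order all_algebra.
From mathcomp Require Import all_classical all_reals all_analysis.
From mathcomp Require Import measurable_realfun lra.
Import Order.TTheory GRing.Theory Num.Theory numFieldNormedType.Exports.

Set Implicit Arguments.
Unset Strict Implicit.
Unset Printing Implicit Defensive.

Local Open Scope classical_set_scope.
Local Open Scope ring_scope.

(** * Probabilities as real numbers *)

Definition prob {d} {T : measurableType d} {R : realType}
  (Q : probability T R) (A : set T) : R := fine (Q A).

Section RealProbability.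
Context d (T : measurableType d) (R : realType) (Q : probability T R).
Implicit Types A B : set T.

Lemma probE A : measurable A -> Q A = (prob Q A)%:E.
Proof. by move=> mA; rewrite /prob fineK// fin_num_measure. Qed.

Lemma prob_le A B : measurable A -> measurable B -> A `<=` B ->
  prob Q A <= prob Q B.
Proof. by move=> mA mB AB; rewrite -lee_fin -!probE// le_measure ?inE. Qed.

Lemma prob_ge0 A : 0 <= prob Q A.
Proof. by rewrite /prob fine_ge0. Qed.

Lemma prob_setT : prob Q setT = 1.
Proof. by rewrite /prob probability_setT. Qed.

Lemma probD A B : measurable A -> measurable B -> B `<=` A ->
  prob Q (A `\` B) = prob Q A - prob Q B.
Proof.
move=> mA mB BA; apply: EFin_inj.
by rewrite EFinB -!probE ?measureD ?setIidr//;
  [rewrite ltey_eq fin_num_measure|exact: measurableD].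
Qed.

Lemma prob_setC A : measurable A -> prob Q (~` A) = 1 - prob Q A.
Proof. by move=> mA; rewrite -setTD probD// prob_setT. Qed.

Lemma probUI A B : measurable A -> measurable B ->
  prob Q (A `|` B) + prob Q (A `&` B) = prob Q A + prob Q B.
Proof.
move=> mA mB; apply: EFin_inj; rewrite !EFinD -!probE//;
  [|exact: measurableI|exact: measurableU].
rewrite measureUfinr//; last by rewrite ltey_eq fin_num_measure.
by rewrite subeK// fin_num_measure//; exact: measurableI.
Qed.

Lemma probU_le A B : measurable A -> measurable B ->
  prob Q (A `|` B) <= prob Q A + prob Q B.
Proof. by move=> mA mB; rewrite -probUI// lerDl prob_ge0. Qed.

End RealProbability.

(** * Quantiles of atomless random variables *)

Section AtomlessVariable.
Context d (T : measurableType d) (R : realType) (Q : probability T R).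
Variables (X : T -> R) (mX : measurable_fun setT X).
Hypothesis X_atomless : forall c, Q [set w | X w = c] = 0%E.

Let m_gt c : measurable [set w | c < X w].
Proof.
have := mX measurableT (measurable_itv `]c, +oo[).
by rewrite setTI; congr measurable; apply/seteqP; split => w /=;
  rewrite in_itv/= andbT.
Qed.

Let m_ge c : measurable [set w | c <= X w].
Proof.
have := mX measurableT (measurable_itv `[c, +oo[).
by rewrite setTI; congr measurable; apply/seteqP; split => w /=;
  rewrite in_itv/= andbT.
Qed.

Let m_eq c : measurable [set w | X w = c].
Proof. by have := mX measurableT (measurable_set1 c); rewrite setTI. Qed.

Lemma prob_ge_gt c : Q [set w | c <= X w] = Q [set w | c < X w].
Proof.
rewrite -(@measureU0 _ _ _ Q [set w | c < X w] [set w | X w = c]);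
  [|exact: m_gt|exact: m_eq|exact: X_atomless].
congr (Q _); apply/seteqP; split => w /=.
  by rewrite le_eqVlt => /predU1P[->|]; [right|left].
by move=> [/ltW|->].
Qed.

(** Right continuity is that of the complementary distribution function of [X]; left continuity is
    right continuity of the distribution function of [- X], where the absence of atoms lets [<=]
    replace [<]. *)
Lemma prob_gt_continuous : continuous (fun c => prob Q [set w | c < X w]).
Proof.
move=> c.
pose Y : {RV Q >-> R} := HB.pack X (isMeasurableFun.Build _ _ _ _ X mX).
have mN : measurable_fun setT (- X) by exact: measurable_funN.
pose Z : {RV Q >-> R} := HB.pack (- X) (isMeasurableFun.Build _ _ _ _ (- X) mN).
have YE u : ccdf Y u = Q [set w | u < X w].
  by congr (Q _); apply/seteqP; split => w /=; rewrite in_itv/= andbT.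
have ZE u : cdf Z u = Q [set w | - u < X w].
  rewrite -prob_ge_gt; congr (Q _); apply/seteqP; split => w /=;
    by rewrite in_itv/= lerNl.
apply/left_right_continuousP; split; last first.
  apply: fine_cvg; rewrite -probE//.
  by have := @ccdf_right_continuous _ _ _ _ Y c; rewrite (funext YE).
apply/cvg_at_leftNP; apply: fine_cvg; rewrite -probE//.
by have := @cdf_right_continuous _ _ _ _ Z (- c); rewrite (funext ZE) opprK.
Qed.

Lemma prob_gt_IVT alpha : 0 < alpha < 1 ->
  exists c, Q [set w | c < X w] = alpha%:E.
Proof.
move=> /andP[a0 a1].
pose Y : {RV Q >-> R} := HB.pack X (isMeasurableFun.Build _ _ _ _ X mX).
have YE u : ccdf Y u = (prob Q [set w | u < X w])%:E.
  by rewrite -probE//; congr (Q _); apply/seteqP; split => w /=;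
    rewrite in_itv/= andbT.
(* The signs of [l] and [u] serve to order the endpoints for [IVT]. *)
have [l [l0 ll]] : exists l, l <= 0 /\ alpha < prob Q [set w | l < X w].
  have := @cvg_ccdfNy1 _ _ _ _ Y; rewrite (funext YE).
  move=> /fine_cvg /= /cvgr_gt /(_ _ a1) H.
  near (-oo%R : set_system R) => l; exists l; split; near: l => //.
  exact: nbhs_ninfty_le.
have [u [u0 uu]] : exists u, 0 <= u /\ prob Q [set w | u < X w] < alpha.
  have := @cvg_ccdfy0 _ _ _ _ Y; rewrite (funext YE).
  move=> /fine_cvg /= /cvgr_lt /(_ _ a0) H.
  near (+oo%R : set_system R) => u; exists u; split; near: u => //.
  exact: nbhs_pinfty_ge.
have [||c _ cE] := @IVT R (fun c => prob Q [set w | c < X w]) l u alpha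
  (le_trans l0 u0).
- by apply: continuous_subspaceT; exact: prob_gt_continuous.
- by rewrite ge_min le_max (ltW uu) (ltW ll) orbT.
by exists c; rewrite probE// cE.
Unshelve. all: by end_near. Qed.

End AtomlessVariable.

(** * Laws on the plane with a positive density *)

Section Plane.
Context {R : realType}.
Implicit Types (i : 'I_2) (c : R).

Lemma ord2_cases i : i = ord0 \/ i = ord_max.
Proof. by case: i => [[|[|//]] Hi]; [left|right]; apply: val_inj. Qed.

Definition other i : 'I_2 := if i == ord0 then ord_max else ord0.

Lemma otherK : involutive other.
Proof. by move=> i; have [->|->] := ord2_cases i. Qed.

(** With [other] and [pair_of], lets an argument that singles out one coordinate be written once for
    both values of [i]. *)
Lemma forall_ord2 i (Q : 'I_2 -> Prop) : Q i -> Q (other i) -> forall j, Q j.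
Proof.
by have [->|->] := ord2_cases i; rewrite /other/= => Q0 Q1 j;
  have [->|->] := ord2_cases j.
Qed.

Definition pair_of i (s t : R) : R * R := if i == ord0 then (s, t) else (t, s).

Lemma component_pair_of i (s t : R) : component i (pair_of i s t) = s.
Proof. by have [->|->] := ord2_cases i. Qed.

Lemma component_other_pair_of i (s t : R) :
  component (other i) (pair_of i s t) = t.
Proof. by have [->|->] := ord2_cases i. Qed.

Lemma measurable_component i :
  measurable_fun setT (component i : R * R -> R).
Proof.
by have [->|->] := ord2_cases i; [exact: measurable_fst|exact: measurable_snd].
Qed.

Lemma measurable_component_gt i c :
  measurable [set x : R * R | c < component i x].
Proof.
have := measurable_component i measurableT (measurable_itv `]c, +oo[).
by rewrite setTI; congr measurable; apply/seteqP; split => w /=;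
  rewrite in_itv/= andbT.
Qed.

Lemma measurable_component_ge i c :
  measurable [set x : R * R | c <= component i x].
Proof.
have := measurable_component i measurableT (measurable_itv `[c, +oo[).
by rewrite setTI; congr measurable; apply/seteqP; split => w /=;
  rewrite in_itv/= andbT.
Qed.

Lemma measurable_component_eq i c :
  measurable [set x : R * R | component i x = c].
Proof.
by have := measurable_component i measurableT (measurable_set1 c);
  rewrite setTI.
Qed.

Lemma lebesgue_line i c :
  (lebesgue_measure \x lebesgue_measure)%E [set x : R * R | component i x = c]
    = 0%E.
Proof.
have [->|->] := ord2_cases i.
- rewrite (_ : [set x | _] = [set c] `*` setT); last first.
    by apply/seteqP; split => -[x1 x2] /=; rewrite /component/=; [|case].
  by rewrite product_measure1E//= lebesgue_measure_set1 mul0e.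
- rewrite (_ : [set x | _] = setT `*` [set c]); last first.
    by apply/seteqP; split => -[x1 x2] /=; rewrite /component/=; [|case].
  by rewrite product_measure1E//= lebesgue_measure_set1 mule0.
Qed.

(** Half-open sides make this exactly an open quadrant minus the union of two others. *)
Definition rectangle (z w : R * R) : set (R * R) :=
  `]z.1, w.1]%classic `*` `]z.2, w.2]%classic.

Lemma measurable_rectangle z w : measurable (rectangle z w).
Proof. by apply: measurableX; exact: measurable_itv. Qed.

Lemma lebesgue_rectangle z w : z.1 < w.1 -> z.2 < w.2 ->
  ((lebesgue_measure \x lebesgue_measure) (rectangle z w) != 0)%E.
Proof.
move=> zw1 zw2; rewrite product_measure1E//= !lebesgue_measure_itv/= !lte_fin.
by rewrite zw1 zw2 -!EFinB -EFinM eqe mulf_neq0// subr_eq0 gt_eqF.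
Qed.

End Plane.

(** * Null sets and positivity under the densities *)

Section Density.
Context {R : realType} {P : R * R -> probability (R * R)%type R}.
Hypothesis Pdens : positive_densities P.
Implicit Types (i : 'I_2) (theta : R * R).

Lemma density_null theta (A : set (R * R)) : measurable A ->
  ((lebesgue_measure \x lebesgue_measure) A = 0)%E -> P theta A = 0%E.
Proof.
move=> mA A0; have [f [mf _ ->//]] := Pdens theta.
apply: null_set_integral => //.
by apply/measurable_EFinP; exact: measurable_funTS.
Qed.

(** A zero integral of [f] over [A] makes [f] vanish almost everywhere on [A], and [f] vanishes
    nowhere. *)
Lemma density_pos theta (A : set (R * R)) : measurable A ->
  P theta A = 0%E -> ((lebesgue_measure \x lebesgue_measure) A = 0)%E.
Proof.
have [f [mf f0 PE]] := Pdens theta.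
move=> mA; rewrite PE// => A0.
have mfA : measurable_fun A (fun x => (f x)%:E).
  by apply/measurable_EFinP; exact: measurable_funTS.
have [|N [mN N0 NA]] :=
    (ae_eq_integral_abs (lebesgue_measure \x lebesgue_measure)%E mA mfA).1.
  by rewrite -[RHS]A0; apply: eq_integral => x _;
    rewrite gee0_abs// lee_fin ltW.
apply: measure_negligible => //; exists N; split=> // x Ax;
  apply: NA => /= /(_ Ax) [] /eqP.
by rewrite gt_eqF.
Qed.

Lemma density_line theta i c : P theta [set x | component i x = c] = 0%E.
Proof.
by apply: density_null; [exact: measurable_component_eq|exact: lebesgue_line].
Qed.

(** Strict inequalities between probabilities are obtained below by fitting a rectangle into a
    difference of events. *)
Lemma density_rectangle theta (z w : R * R) : z.1 < w.1 -> z.2 < w.2 ->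
  0 < prob (P theta) (rectangle z w).
Proof.
move=> zw1 zw2; rewrite lt_def prob_ge0 andbT; apply/eqP => zw0.
have mzw := measurable_rectangle z w.
have := @density_pos theta _ mzw; rewrite probE// zw0 => /(_ erefl).
by apply/eqP; exact: lebesgue_rectangle.
Qed.

End Density.

(** * Marginal tail probabilities and existence of the thresholds *)

Section Tails.
Context {R : realType} {P : R * R -> probability (R * R)%type R}.
Hypotheses (Pmarg : marginals_depend_on_own P) (Pdiv : marginals_diverge P)
  (Pdens : positive_densities P) (Pmono : monotone_family P).
Implicit Types (i : 'I_2) (theta gamma : R * R) (s t c : R).

Definition tail i t c : R := prob (P (t, t)) [set x | c < component i x].

Lemma marginalE i t c : marginal P i t [set u | c < u] = (tail i t c)%:E.
Proof. by rewrite /tail -probE//; exact: measurable_component_gt. Qed.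

Lemma component_diag i t : component i (t, t) = t.
Proof. by have [->|->] := ord2_cases i. Qed.

Lemma prob_component_gt i theta c :
  prob (P theta) [set x | c < component i x] = tail i (component i theta) c.
Proof.
rewrite /tail /prob; congr fine.
have := @Pmarg i theta (component i theta, component i theta).
rewrite component_diag => /(_ erefl `]c, +oo[%classic (measurable_itv _)).
rewrite (_ : _ @^-1` _ = [set x | c < component i x])//.
by apply/seteqP; split => x /=; rewrite in_itv/= andbT.
Qed.

Lemma prob_component_ge i theta c :
  prob (P theta) [set x | c <= component i x] = tail i (component i theta) c.
Proof.
rewrite -prob_component_gt /prob; congr fine.
apply: prob_ge_gt; first exact: measurable_component.
by move=> ?; exact: density_line.
Qed.

Lemma prob_component_lt i theta c :
  prob (P theta) [set x | component i x < c] = 1 - tail i (component i theta) c.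
Proof.
rewrite -prob_component_ge -prob_setC; last exact: measurable_component_ge.
by congr prob; apply/seteqP; split => x /=; rewrite ltNge => /negP.
Qed.

(** This is the monotonicity of the family at the sign vector [(1, 1)]. *)
Lemma prob_monotone (M : set (R * R)) theta gamma : measurable M ->
  monotone_increasing M ->
  (forall i, component i theta <= component i gamma) ->
  prob (P theta) M <= prob (P gamma) M.
Proof.
move=> mM iM tg; have d1 i : component i ((1, 1) : R * R) = 1.
  by have [->|->] := ord2_cases i.
have := @Pmono (1, 1) (fun i => or_introl (d1 i)) M mM iM theta gamma.
rewrite (_ : [set x | _] = M); last first.
  by apply/seteqP; split => -[x1 x2] /=; rewrite !mul1r.
rewrite !probE// lee_fin; apply => i.
by rewrite d1 !mul1r.
Qed.

Lemma tail_le i c s t : s <= t -> tail i s c <= tail i t c.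
Proof.
move=> st; apply: prob_monotone; first exact: measurable_component_gt.
  by move=> x y /= cx xy; exact: lt_le_trans (xy i).
by move=> j; rewrite !component_diag.
Qed.

(** For either coordinate, the strip between the two half-planes contains the square with both sides
    []c, d]]. *)
Lemma tail_lt i t c d : c < d -> tail i t d < tail i t c.
Proof.
move=> cd; have mc := measurable_component_gt i c.
have md := measurable_component_gt i d.
rewrite -subr_gt0 -probD//; last by move=> x /=; exact: lt_trans.
apply: lt_le_trans (@density_rectangle _ _ Pdens (t, t) (c, c) (d, d) cd cd) _.
apply: prob_le; [exact: measurable_rectangle|exact: measurableD|].
move=> x [/=]; rewrite !in_itv/= => /andP[cx1 x1d] /andP[cx2 x2d].
by have [->|->] := ord2_cases i; rewrite /component/=; split => //; apply/negP;
  rewrite -leNgt.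
Qed.

Lemma ltr_tail i t : {mono tail i t : c d /~ c < d}.
Proof.
move=> c d; apply/idP/idP => [|/(tail_lt i t)->//].
case: (ltgtP d c) => // [dc|->]; last by rewrite ltxx.
by rewrite ltNge (ltW (tail_lt i t dc)).
Qed.

Lemma tail_inj i t : injective (tail i t).
Proof.
by move=> c d cd; case: (ltgtP c d) => // /(tail_lt i t); rewrite cd ltxx.
Qed.

Lemma tail_ge0 i t c : 0 <= tail i t c.
Proof. exact: prob_ge0. Qed.

Lemma tail_lt1 i t c : tail i t c < 1.
Proof.
apply: lt_le_trans (@tail_lt i t (c - 1) c _) _; first by rewrite gtrBl.
by rewrite -(@prob_setT _ _ _ (P (t, t))) prob_le//;
  exact: measurable_component_gt.
Qed.

Lemma tail_continuous i t : continuous (tail i t).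
Proof.
apply: prob_gt_continuous; first exact: measurable_component.
by move=> ?; exact: density_line.
Qed.

Lemma tail_surj i t p : 0 < p < 1 -> exists c, tail i t c = p.
Proof.
move=> p01.
have [|c cE] := @prob_gt_IVT _ _ _ (P (t, t)) (component i)
    (measurable_component i) _ p p01; first by move=> ?; exact: density_line.
by exists c; rewrite /tail /prob cE.
Qed.

(** [marginals_diverge] gives the limit 1 for [X_i < c]; the complement [c <= X_i] has the
    probability of [c < X_i] because lines are null. *)
Lemma tail_cvgNy i c : tail i t c @[t --> -oo] --> (0 : R).
Proof.
have [+ _] := Pdiv i c.
rewrite (_ : (fun t => _) = (fun t => (1 - tail i t c)%:E)); last first.
  apply/funext => t; rewrite -[X in tail i X](component_diag i).
  rewrite -prob_component_lt -probE//.
  have := measurableC (measurable_component_ge i c); congr measurable.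
  by apply/seteqP; split => x /=; rewrite ltNge => /negP.
move=> /fine_cvg /= h.
rewrite (_ : tail i ^~ c = (fun t => 1 - (1 - tail i t c))); last first.
  by apply/funext => t; rewrite subKr.
by rewrite -[X in _ --> X](subrr 1); apply: cvgB => //; exact: cvg_cst.
Qed.

Lemma tail_cvgy i c : tail i t c @[t --> +oo] --> (1 : R).
Proof.
have [_] := Pdiv i c.
rewrite (_ : (fun t => _) = (fun t => (tail i t c)%:E)); last first.
  by apply/funext => t; exact: marginalE.
by move=> /fine_cvg.
Qed.

Lemma tail_right_continuous (eps : R * R) (Prc : marginals_right_continuous_at P
  eps)
  i c :
  tail i t c @[t --> (component i eps)^'+] --> tail i (component i eps) c.
Proof.
have := Prc i c; rewrite marginalE.
rewrite (_ : (fun t => _) = (fun t => (tail i t c)%:E)); last first.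
  by apply/funext => t; exact: marginalE.
by move=> /fine_cvg.
Qed.

Lemma exceeds_someE (a : R * R) :
  exceeds_some a = [set x | exists i, component i a < component i x].
Proof.
apply/seteqP; split => x /=; first by case=> ax; [exists ord0|exists ord_max].
by move=> [i]; have [->|->] := ord2_cases i; [left|right].
Qed.

Lemma measurable_exceeds_some (a : R * R) : measurable (exceeds_some a).
Proof.
rewrite (_ : exceeds_some a =
  [set x | a.1 < component ord0 x] `|` [set x | a.2 < component ord_max x])//.
by apply: measurableU; exact: measurable_component_gt.
Qed.

(* With [G_i = tail i eps_i], the event [X_1 > a_1 or X_2 > a_2] for thresholds
   such that [G_1 a_1 = G_2 a_2 = p] is [min (G_1 X_1) (G_2 X_2) < p]; so [p] is
   a quantile of an atomless random variable. *)
Lemma first_thresholds_exist alpha (eps : R * R) : 0 < alpha < 1 ->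
  exists a, first_thresholds P alpha eps a.
Proof.
move=> a01; pose G i : R -> R := tail i (component i eps).
have mG i : measurable_fun setT (fun x : R * R => G i (component i x)).
  apply: (@measurableT_comp _ _ _ _ _ _ (G i));
    last exact: measurable_component.
  apply: nonincreasing_measurable => // c d; rewrite le_eqVlt.
  by move=> /predU1P[->//|/tail_lt /ltW]; exact.
(* The sign turns the lower event for the minimum into an upper tail of [T], so that [prob_gt_IVT]
   applies; its quantile [q] is [- p]. *)
pose T x := - Order.min (G ord0 (component ord0 x)) (G ord_max (component
  ord_max x)).
have mT : measurable_fun setT T.
  apply: measurable_funN; exact: measurable_minr.
(* [G i] is injective, so each of its level sets is a line or empty. *)
have lineG i p : P (0, 0) [set x | G i (component i x) = p] = 0%E.
  have [[c cp]|nc] := pselect (exists c, G i c = p); last first.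
    rewrite (_ : [set x | _] = set0) ?measure0//.
    by apply/seteqP; split => // x /= xp; apply: nc; exists (component i x).
  rewrite (_ : [set x | _] = [set x | component i x = c]);
    first exact: density_line.
  by apply/seteqP; split => x /=; rewrite -cp; [exact: tail_inj|move=> ->].
have T_atomless c : P (0, 0) [set x | T x = c] = 0%E.
  apply/eqP; rewrite -measure_le0.
  have mE i : measurable [set x : R * R | G i (component i x) = - c].
    by have := mG i measurableT _ (measurable_set1 (- c)); rewrite setTI.
  rewrite -[leRHS](lineG ord0 (- c)).
  rewrite -(@measureU0 _ _ _ (P (0, 0)) [set x | G ord0 (component ord0 x) = -
    c]
     _ (mE _) (mE ord_max) (lineG _ _)).
  apply: le_measure; rewrite ?inE.
  - by have := mT measurableT _ (measurable_set1 c); rewrite setTI.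
  - exact: measurableU.
  - move=> x /= <-; rewrite /T opprK minEle; case: ifP => _; [by left|by right].
have [q qE] := @prob_gt_IVT _ _ _ (P (0, 0)) T mT T_atomless alpha a01.
have qT x : (q < T x) = (G ord0 (component ord0 x) < - q) ||
                        (G ord_max (component ord_max x) < - q).
  by rewrite /T ltrNr gt_min.
have /andP[a0 a1] := a01.
(* [- q <= 0] would make the event empty and [1 <= - q] would make it the whole plane, against
   [0 < alpha < 1]. *)
have p0 : 0 < - q.
  rewrite ltNge; apply/negP => q0; move: a0.
  rewrite -lte_fin -qE (_ : [set x | _] = set0) ?measure0 ?ltxx//.
  apply/seteqP; split => // x /=; rewrite qT => /orP[] /lt_le_trans/(_ q0);
    by rewrite ltNge tail_ge0.
have p1 : - q < 1.
  rewrite ltNge; apply/negP => q1; move: a1.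
  rewrite -lte_fin -qE (_ : [set x | _] = setT) ?probability_setT ?ltxx//.
  by apply/seteqP; split => // x _ /=; rewrite qT (lt_le_trans _ q1)// tail_lt1.
have p01 : 0 < - q < 1 by rewrite p0.
have [a1' a1E] := tail_surj ord0 eps.1 p01.
have [a2' a2E] := tail_surj ord_max eps.2 p01.
exists (a1', a2'); split; last by rewrite !marginalE/= a1E a2E.
rewrite -qE; congr (P _ _); apply/seteqP; split => x /=; rewrite qT.
  by case=> h; apply/orP; [left; rewrite -a1E|right; rewrite -a2E];
    rewrite /G ltr_tail.
by case/orP; [rewrite -a1E|rewrite -a2E]; rewrite /G ltr_tail => h;
  [left|right].
Qed.

Lemma second_thresholds_exist alpha : 0 < alpha < 1 ->
  exists b, second_thresholds P alpha b.
Proof.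
move=> a01; have [b1 b1E] := tail_surj ord0 0 a01.
have [b2 b2E] := tail_surj ord_max 0 a01.
exists (b1, b2) => i; rewrite /marginal probE;
  last exact: measurable_component_ge.
congr EFin; apply: etrans (prob_component_ge i (0, 0) _) _.
by have [->|->] := ord2_cases i.
Qed.

End Tails.

(** * Rejecting at least one hypothesis *)

Section Rules.
Context {R : realType}.
Implicit Types (i : 'I_2) (D : @rule R) (x y : R * R).

Lemma reject_anyP D x : (~` region D false false) x <-> exists i, i \in D x.
Proof.
split=> [D00|[i iD] [D0 D1]].
- case D0 : (ord0 \in D x); first by exists ord0.
  by case D1 : (ord_max \in D x); [exists ord_max|case: D00].
- by move: iD; have [->|->] := ord2_cases i; rewrite ?D0 ?D1.
Qed.

Lemma measurable_reject_any D : measurable_rule D ->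
  measurable (~` region D false false).
Proof.
move=> mD; rewrite (_ : ~` _ = rejects D ord0 `|` rejects D ord_max).
  exact: measurableU.
apply/seteqP; split => x.
  by move=> /reject_anyP[i]; have [->|->] := ord2_cases i; [left|right].
by move=> h; apply/reject_anyP; case: h; [exists ord0|exists ord_max].
Qed.

Lemma measurable_reject_both D : measurable_rule D ->
  measurable (region D true true).
Proof. by move=> mD; exact: measurableI (mD ord0) (mD ord_max). Qed.

Lemma measurable_rejects_in D (I : set 'I_2) : measurable_rule D ->
  measurable [set x | exists2 i, I i & i \in D x].
Proof.
move=> mD; apply: (fin_bigcup_measurable (F := rejects D)) => [|i _].
  exact: finite_finset.
exact: mD.
Qed.

(** If [D x] were empty, monotonicity at [x] would ask only for the strict inequalities downwards,
    and [D y] would be empty too. *)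
Lemma monotone_rule_reject_any D x y : monotone_rule D ->
  (forall i, component i y < component i x) ->
  (exists i, i \in D y) -> exists i, i \in D x.
Proof.
move=> monD yx [i iDy]; apply: contrapT => noDx.
have x0 j : j \notin D x by apply/negP => jDx; apply: noDx; exists j.
suff DE : D y = D x by apply: noDx; exists i; rewrite -DE.
by apply: monD => // j; rewrite (negbTE (x0 j)).
Qed.

Lemma A1P (eps theta : R * R) :
  A1 eps theta <-> exists i, component i eps < component i theta.
Proof.
split=> [[]|[i]]; [by exists ord0|by exists ord_max|].
by have [->|->] := ord2_cases i; [left|right].
Qed.

End Rules.

(** * Sharp bounds for the minimum power over [A1 eps] *)

Section AnyRejection.
Context {R : realType} {P : R * R -> probability (R * R)%type R}.
Hypotheses (Pmarg : marginals_depend_on_own P) (Pdiv : marginals_diverge P)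
  (Pdens : positive_densities P) (Pmono : monotone_family P).
Context {alpha : R} {eps a : R * R}.
Hypotheses (Prc : marginals_right_continuous_at P eps)
  (aP : first_thresholds P alpha eps a).
Implicit Types (i : 'I_2) (D : @rule R) (S : set (R * R)).

Local Notation tail := (@tail R P).

Lemma tail_thresholds i :
  tail i (component i eps) (component i a) = tail ord0 eps.1 a.1.
Proof.
have [_] := aP; rewrite !marginalE => -[aE].
by have [->|->] := ord2_cases i.
Qed.

(* Let theta_i decrease to eps_i and the other parameter tend to -oo. *)
Lemma bound_over_A1 (v : \bar R) S i c t : measurable S ->
  S `<=` [set x | c <= component i x \/ t <= component (other i) x] ->
  (forall theta, A1 eps theta -> (v <= P theta S)%E) ->
  (v <= (tail i (component i eps) c)%:E)%E.
Proof.
move=> mS Sct vP; apply/lee_addgt0Pr => e e0.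
have e20 : 0 < e / 2 by rewrite divr_gt0.
have [s [eps_s sc]] : exists s, component i eps < s /\
    tail i s c < tail i (component i eps) c + e / 2.
  have /cvgr_lt/(_ (tail i (component i eps) c + e / 2)) :=
    @tail_right_continuous _ _ _ Prc i c.
  rewrite ltrDl => /(_ e20) h.
  near (component i eps)^'+ => s; exists s; split; near: s => //.
  exact: nbhs_right_gt.
have [u ut] : exists u, tail (other i) u t < e / 2.
  have /cvgr_lt/(_ (e / 2) e20) h := @tail_cvgNy _ _ Pmarg Pdiv Pdens (other i)
    t.
  by near (-oo%R : set_system R) => u; exists u; near: u.
pose theta := pair_of i s u.
apply: le_trans (vP theta _) _.
  by apply/A1P; exists i; rewrite component_pair_of.
rewrite probE// lee_fin.
have mU := measurableU _ _ (measurable_component_ge i c)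
  (measurable_component_ge (other i) t).
apply: le_trans (prob_le _ _ mU Sct) _ => //.
apply: le_trans (probU_le _ _ _) _; [exact: measurable_component_ge..|].
rewrite !prob_component_ge// component_pair_of component_other_pair_of.
lra.
Unshelve. all: by end_near. Qed.

(** Continuity of the tail in its threshold lets [c] increase to [a_i]; the equal-power condition
    makes the resulting bound the same for both coordinates. *)
Lemma bound_over_A1_continuous (v : \bar R) i :
  (forall c, c < component i a -> (v <= (tail i (component i eps) c)%:E)%E) ->
  (v <= (tail ord0 eps.1 a.1)%:E)%E.
Proof.
move=> vP; apply/lee_addgt0Pr => e e0; rewrite -(tail_thresholds i).
have [c [ca cE]] : exists c, c < component i a /\
    tail i (component i eps) c <
    tail i (component i eps) (component i a) + e.
  have /left_right_continuousP[/cvgr_lt h _] :=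
    @tail_continuous _ _ Pdens i (component i eps) (component i a).
  have {}h := h _ (ltr_pwDr e0 (lexx _)).
  near (component i a)^'- => c; exists c; split; near: c => //.
  exact: nbhs_left_lt.
by apply: le_trans (vP c ca) _; rewrite -EFinD lee_fin ltW.
Unshelve. all: by end_near. Qed.

Lemma prob_exceeds_some : prob (P (0, 0)) (exceeds_some a) = alpha.
Proof. by have [aE _] := aP; rewrite /prob aE. Qed.

Lemma prob_exceeds_some_lt (c : R * R) :
  (forall i, component i c < component i a) ->
  alpha < prob (P (0, 0)) (exceeds_some c).
Proof.
move=> ca; rewrite -prob_exceeds_some -subr_gt0.
have ca1 := ca ord0; have ca2 := ca ord_max.
have mc := measurable_exceeds_some c; have ma := measurable_exceeds_some a.
rewrite -probD//; last first.
  by move=> x []; [left|right]; [exact: lt_trans ca1 _|exact: lt_trans ca2 _].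
apply: lt_le_trans (density_rectangle Pdens (0, 0) ca1 ca2) _.
apply: prob_le; [exact: measurable_rectangle|exact: measurableD|].
move=> x [/=]; rewrite !in_itv/= => /andP[cx1 x1a] /andP[cx2 x2a].
by split; [left|case; rewrite ltNge ?x1a ?x2a].
Qed.

Lemma inf_reject_any_le D : ruleC P alpha D ->
  (inf_reject_any P eps D <= (tail ord0 eps.1 a.1)%:E)%E.
Proof.
move=> [mD monD fwerD]; rewrite leNgt; apply/negP => lt_inf.
have mRD := measurable_reject_any mD.
(* Otherwise each [c < a_i] has some [t] at which nothing is rejected; then every rejection needs
   [c <= x_i] or [t] at most the other coordinate, and [bound_over_A1] applies. *)
have rejects_ray i : exists c,
    c < component i a /\ forall t, exists j, j \in D (pair_of i c t).
  apply: contrapT => /forallNP no_ray; move: lt_inf; rewrite ltNge => /negP;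
    apply.
  apply: (@bound_over_A1_continuous _ i) => c ca.
  have [t ntD] : exists t, ~ exists j, j \in D (pair_of i c t).
    by apply: contrapT => /forallNP h; apply: (no_ray c); split=> // t;
      exact: contrapT (h t).
  apply: (@bound_over_A1 _ _ i c t mRD) => [x /reject_anyP xD|theta A1t];
    last first.
    by apply: ereal_inf_lbound; exists theta.
  apply: contrapT => /not_orP[/negP + /negP]; rewrite -!ltNge => xc xt.
  apply: ntD; apply: monotone_rule_reject_any monD _ xD.
  by apply: (@forall_ord2 i);
    rewrite ?component_pair_of ?component_other_pair_of.
have [c1 [c1a ray1]] := rejects_ray ord0.
have [c2 [c2a ray2]] := rejects_ray ord_max.
(* A point with [c1 < x.1] lies strictly above the ray point [(c1, x.2 - 1)]; the second coordinate
   is symmetric. *)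
have sub : exceeds_some (c1, c2) `<=` ~` region D false false.
  move=> x [/= c1x|/= c2x]; apply/reject_anyP.
  - apply: monotone_rule_reject_any monD _ (ray1 (x.2 - 1)).
    by apply: (@forall_ord2 ord0) => //=; rewrite /component/= gtrBl.
  - apply: monotone_rule_reject_any monD _ (ray2 (x.1 - 1)).
    by apply: (@forall_ord2 ord_max) => //=; rewrite /component/= gtrBl.
(* At [(0, 0)] both hypotheses are true, so the error bound covers every rejection. *)
have := fwerD (0, 0).
rewrite (_ : [set x | _] = ~` region D false false); last first.
  apply/seteqP; split => x; first by move=> [i _ iD]; apply/reject_anyP;
    exists i.
  move=> /reject_anyP[i iD]; exists i => //; rewrite /true_hyp.
  by have [->|->] := ord2_cases i.
rewrite probE// lee_fin leNgt => /negP; apply.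
apply: lt_le_trans (@prob_exceeds_some_lt (c1, c2) _) _.
  exact: (@forall_ord2 ord0).
by apply: prob_le => //; exact: measurable_exceeds_some.
Qed.

Lemma prob_ge_over_A1 theta i S : measurable S ->
  [set x | component i a < component i x] `<=` S ->
  component i eps < component i theta ->
  ((tail ord0 eps.1 a.1)%:E <= P theta S)%E.
Proof.
move=> mS aS eps_theta; rewrite probE// lee_fin -(tail_thresholds i).
apply: le_trans (tail_le Pmono i _ (ltW eps_theta)) _.
by rewrite -prob_component_gt// prob_le//; exact: measurable_component_gt.
Qed.

(** Through this, the upper bound on [inf_reject_any] also bounds [inf_reject_false]. *)
Lemma inf_reject_false_le_any D : measurable_rule D ->
  (inf_reject_false P eps D <= inf_reject_any P eps D)%E.
Proof.
move=> mD; apply: le_ereal_inf_tmp => _ [theta A1t <-].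
apply: le_trans (ereal_inf_lbound _) _; first by exists theta.
apply: le_measure; rewrite ?inE.
- exact: measurable_rejects_in.
- exact: measurable_reject_any.
- by move=> x [i _ iD]; apply/reject_anyP; exists i.
Qed.

Hypothesis eps_gt0 : 0 < eps.1 /\ 0 < eps.2.

(** A coordinate with [eps_i < theta_i] has [0 < theta_i], so rejecting [H_i] on [X_i > a_i] is
    correct. *)
Lemma inf_reject_false_ge D : measurable_rule D ->
  (forall i, [set x | component i a < component i x] `<=` rejects D i) ->
  ((tail ord0 eps.1 a.1)%:E <= inf_reject_false P eps D)%E.
Proof.
move=> mD aD; apply: le_ereal_inf_tmp => _ [theta /A1P[i eps_theta] <-].
apply: (@prob_ge_over_A1 _ i) => //; first exact: measurable_rejects_in.
move=> x /aD iD; exists i => //; rewrite /true_hyp; apply/negP; rewrite -ltNge.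
apply: lt_trans eps_theta; have [? ?] := eps_gt0.
by have [->|->] := ord2_cases i.
Qed.

(** The common power bounds [inf_reject_false] below, hence also [inf_reject_any], which it bounds
    above; all three coincide. *)
Lemma optimal_reject_any D : ruleC P alpha D ->
  (forall i, [set x | component i a < component i x] `<=` rejects D i) ->
  inf_reject_any P eps D = (tail ord0 eps.1 a.1)%:E /\
  inf_reject_false P eps D = (tail ord0 eps.1 a.1)%:E.
Proof.
move=> CD aD; have [mD _ _] := CD.
have le1 := inf_reject_any_le CD; have le2 := inf_reject_false_le_any mD.
have le3 := inf_reject_false_ge mD aD.
by split; apply/eqP;
  rewrite eq_le ?le1 ?le3 ?(le_trans le3 le2) ?(le_trans le2 le1).
Qed.

End AnyRejection.

(** * Rejecting both hypotheses *)

Section StepdownRule.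
Context {R : realType}.
Implicit Types (i : 'I_2) (D : @rule R) (a b x y : R * R).

(** Given index by index rather than by regions, to suit the check of monotonicity: the second
    disjunct is the second step, taken once the other hypothesis has passed its first threshold. *)
Definition stepdown_rule a b : rule := fun x =>
  [set i | (component i a < component i x) ||
    (component i b <= component i x) &&
    (component (other i) a < component (other i) x)]%SET.

Lemma in_stepdown_rule a b x i : (i \in stepdown_rule a b x) =
  (component i a < component i x) ||
  (component i b <= component i x) &&
  (component (other i) a < component (other i) x).
Proof. by rewrite inE. Qed.

Lemma stepdown_rule_monotone a b : monotone_rule (stepdown_rule a b).
Proof.
move=> x y up down; apply/setP => i;
  have [iDx|iDx] := boolP (i \in stepdown_rule a b x).
  have xy := up i iDx; move: iDx; rewrite !in_stepdown_rule.
  move=> /orP[ax|/andP[bx ax]]; first by rewrite (lt_le_trans ax xy).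
  (* The other index passes its first threshold at [x], so it is rejected there and [up] applies to
     it. *)
  rewrite (le_trans bx xy) (lt_le_trans ax) ?orbT// up//.
  by rewrite in_stepdown_rule ax.
have yx := down i iDx; apply/negbTE; apply: contra iDx;
  rewrite !in_stepdown_rule.
move=> /orP[ay|/andP[bay ay]]; first by rewrite (lt_trans ay yx).
rewrite (le_trans bay (ltW yx)).
have [ax|xa] := ltP (component (other i) a) (component (other i) x).
  by rewrite orbT.
(* With the other coordinate of [x] at most its first threshold, rejecting [other i] at [x] takes
   the second step and so [a_i < x_i]; not rejecting it puts [y] below [x] there, against [ay]. *)
have [iDx|/down] := boolP (other i \in stepdown_rule a b x).
  move: iDx; rewrite in_stepdown_rule ltNge xa otherK/= => /andP[_ ->].
  by [].
by move=> /(lt_trans ay) /lt_le_trans/(_ xa); rewrite ltxx.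
Qed.

Variables (a b : R * R).
Hypothesis ba : forall i, component i b < component i a.

Lemma stepdown_rule_any : rejects_any_iff_exceeds a (stepdown_rule a b).
Proof.
rewrite /rejects_any_iff_exceeds/= exceeds_someE.
apply/seteqP; split => x; last first.
  by move=> [i ax]; apply/reject_anyP; exists i; rewrite in_stepdown_rule ax.
move=> /reject_anyP[i]; rewrite in_stepdown_rule => /orP[ax|/andP[_ ax]].
  by exists i.
by exists (other i).
Qed.

Lemma stepdown_rule_both x : region (stepdown_rule a b) true true x <->
  (forall i, component i b <= component i x) /\ exceeds_some a x.
Proof.
have bax i : component i a < component i x -> component i b <= component i x.
  by move=> h; exact: ltW (lt_trans (ba i) h).
rewrite /region/= !in_stepdown_rule exceeds_someE; split.
- move=> [h0 h1]; split; last first.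
    by case/orP: h0 => [|/andP[_]] ax; eexists; exact: ax.
  by apply: (@forall_ord2 ord0); [move: h0|move: h1] => /orP[/bax|/andP[]].
- move=> [bx [i ax]]; rewrite !bx /= /other/=.
  by move: ax; have [->|->] := ord2_cases i => ->; rewrite ?orbT.
Qed.

Lemma stepdown_ruleP : stepdown a b (stepdown_rule a b).
Proof.
have ba0 := ba ord0; have ba1 := ba ord_max; rewrite /component/= in ba0 ba1.
have regE u v x : region (stepdown_rule a b) u v x =
    ((a.1 < x.1) || (b.1 <= x.1) && (a.2 < x.2) = u /\
     (a.2 < x.2) || (b.2 <= x.2) && (a.1 < x.1) = v).
  by rewrite /region/= !in_stepdown_rule.
have ax_bx x : [/\ a.1 < x.1 -> b.1 <= x.1 & a.2 < x.2 -> b.2 <= x.2].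
  by split=> h; [exact: ltW (lt_trans ba0 h)|exact: ltW (lt_trans ba1 h)].
(* What remains is propositional in four comparisons, subject to the two implications [ax_bx]. *)
split; apply/predeqP => x; have [] := ax_bx x;
  rewrite /setI/setC/= ?regE ?(ltNge x.1) ?(ltNge x.2);
  case: (a.1 < x.1); case: (a.2 < x.2); case: (b.1 <= x.1); case: (b.2 <= x.2);
  rewrite /=; intuition discriminate.
Qed.

End StepdownRule.

(** * Quadrants and rectangles *)

Section Quadrants.
Context {R : realType}.
Implicit Types (i : 'I_2) (c x z w : R * R).

Definition quadrant c : set (R * R) := [set x | c.1 < x.1 /\ c.2 < x.2].

Lemma quadrantE c : quadrant c =
  [set x | c.1 < component ord0 x] `&` [set x | c.2 < component ord_max x].
Proof. by []. Qed.

Lemma measurable_quadrant c : measurable (quadrant c).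
Proof.
by rewrite quadrantE; apply: measurableI; exact: measurable_component_gt.
Qed.

Lemma quadrant_increasing c : monotone_increasing (quadrant c).
Proof.
move=> x y [c1 c2] xy.
by split; [exact: lt_le_trans (xy ord0)|exact: lt_le_trans (xy ord_max)].
Qed.

Lemma exceeds_some_increasing c : monotone_increasing (exceeds_some c).
Proof.
move=> x y [] cx xy; [left|right].
  exact: lt_le_trans (xy ord0).
exact: lt_le_trans (xy ord_max).
Qed.

(** Carries convergence over from quadrants, which are increasing, to rectangles, which are not. *)
Lemma prob_rectangle (Q : probability (R * R)%type R) z w :
  z.1 <= w.1 -> z.2 <= w.2 ->
  prob Q (rectangle z w) = prob Q (quadrant z) -
    (prob Q (quadrant (w.1, z.2)) + prob Q (quadrant (z.1, w.2)) -
     prob Q (quadrant w)).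
Proof.
move=> zw1 zw2.
have mq := measurable_quadrant.
have := probUI Q (mq (w.1, z.2)) (mq (z.1, w.2)).
rewrite (_ : _ `&` _ = quadrant w); last first.
  apply/seteqP; split=> x /=; first by move=> [[? _] [_ ?]].
  by move=> [? ?]; split; split=> //=;
    [exact: le_lt_trans zw2 _|exact: le_lt_trans zw1 _].
move=> <-; rewrite addrK -probD//; last 2 first.
- exact: measurableU.
- by move=> x [] [? ?]; split=> //;
    [exact: le_lt_trans zw1 _|exact: le_lt_trans zw2 _].
congr prob; apply/seteqP; split=> x.
  move=> [/=]; rewrite !in_itv/= => /andP[zx1 xw1] /andP[zx2 xw2].
  by split; [split|move=> [[/= h _]|[/= _ h]]; move: h;
    rewrite ltNge ?xw1 ?xw2].
move=> [[zx1 zx2] /not_orP[n1 n2]]; split;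
  rewrite /= in_itv/= ?zx1 ?zx2/= leNgt;
  apply/negP => h.
- exact: n1.
- exact: n2.
Qed.

End Quadrants.

(** * Optimality and uniqueness of the stepdown rule *)

Section BothRejected.
Context {R : realType} {P : R * R -> probability (R * R)%type R}.
Hypotheses (Pmarg : marginals_depend_on_own P) (Pdiv : marginals_diverge P)
  (Pdens : positive_densities P) (Pmono : monotone_family P).
Context {alpha : R} {eps a b : R * R}.
Hypotheses (Prc : marginals_right_continuous_at P eps)
  (aP : first_thresholds P alpha eps a) (bP : second_thresholds P alpha b).
Implicit Types (i : 'I_2) (D : @rule R) (c : R * R).

Local Notation tail := (@tail R P).

(** Strict approach from above in both coordinates keeps [theta] eventually in [A2 eps], while [eps]
    itself lies outside. *)
Definition eps_right : set_system (R * R) :=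
  filter_prod (at_right eps.1) (at_right eps.2).

#[local] Instance eps_right_filter : ProperFilter eps_right.
Proof. by apply: filter_prod_proper. Qed.

Lemma eps_right_A2 : \forall theta \near eps_right, A2 eps theta.
Proof.
exists ([set t | eps.1 < t], [set t | eps.2 < t]) => /=.
  by split; exact: nbhs_right_gt.
by move=> [t1 t2] [].
Qed.

Lemma tail_eps_right i (c : R) :
  tail i (component i theta) c @[theta --> eps_right] -->
  tail i (component i eps) c.
Proof.
have := @tail_right_continuous _ _ _ Prc i c.
have [->|->] := ord2_cases i; rewrite /component/= => h.
- by apply: (cvg_comp (fun theta : R * R => theta.1) (fun t => tail ord0 t c))
    h; exact: cvg_fst.
- by apply: (cvg_comp (fun theta : R * R => theta.2) (fun t => tail ord_max t
    c)) h; exact: cvg_snd.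
Qed.

(* The indicators of a quadrant and of the union of the two half-planes are
   increasing and add up to the sum of the indicators of the half-planes, so
   convergence of the marginals forces convergence on quadrants. *)
Lemma prob_quadrant_eps_right c :
  prob (P theta) (quadrant c) @[theta --> eps_right] -->
  prob (P eps) (quadrant c).
Proof.
have mq := measurable_quadrant c; have me := measurable_exceeds_some c.
have sumE theta : prob (P theta) (exceeds_some c) + prob (P theta) (quadrant c)
  =
    tail ord0 theta.1 c.1 + tail ord_max theta.2 c.2.
  rewrite quadrantE.
  have := probUI (P theta) (measurable_component_gt ord0 c.1)
    (measurable_component_gt ord_max c.2).
  by rewrite !prob_component_gt.
have le_mono theta : A2 eps theta -> forall i, component i eps <= component i
  theta.
  by move=> [/ltW ? /ltW ?]; exact: (@forall_ord2 ord0).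
(* Both increasing events are at least as probable at [theta] as at [eps]: the quadrant gives the
   lower bound, the union through [sumE] the upper one. *)
apply: (@squeeze_cvgr _ _ _ _ (fun=> prob (P eps) (quadrant c))
  (fun theta => tail ord0 theta.1 c.1 + tail ord_max theta.2 c.2 -
                prob (P eps) (exceeds_some c))).
- near=> theta; have /le_mono tge : A2 eps theta by near: theta;
    exact: eps_right_A2.
  have h1 := prob_monotone Pmono mq (@quadrant_increasing _ c) tge.
  have h2 := prob_monotone Pmono me (@exceeds_some_increasing _ c) tge.
  by rewrite h1/=; have := sumE theta; lra.
- exact: cvg_cst.
- have -> : prob (P eps) (quadrant c) =
      tail ord0 eps.1 c.1 + tail ord_max eps.2 c.2 - prob (P eps) (exceeds_some
        c).
    by rewrite -sumE addrC addKr.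
  apply: cvgB; last exact: cvg_cst.
  by apply: cvgD; [exact: (@tail_eps_right ord0)|
    exact: (@tail_eps_right ord_max)].
Unshelve. all: by end_near. Qed.

Lemma bound_over_A2 (v : \bar R) (g : R * R -> R) l :
  g theta @[theta --> eps_right] --> l ->
  (forall theta, A2 eps theta -> (v <= (g theta)%:E)%E) -> (v <= l%:E)%E.
Proof.
move=> gl vg; apply/lee_addgt0Pr => e e0.
move/cvgr_lt : gl => /(_ (l + e)); rewrite ltrDl => /(_ e0) gle.
have [theta [A2t glt]] : exists theta, A2 eps theta /\ g theta < l + e.
  near eps_right => theta; exists theta; split; near: theta => //.
  exact: eps_right_A2.
by apply: le_trans (vg theta A2t) _; rewrite -EFinD lee_fin ltW.
Unshelve. all: by end_near. Qed.

Lemma tail_second_thresholds i : tail i 0 (component i b) = alpha.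
Proof.
have := bP i; rewrite /marginal.
rewrite probE; last exact: measurable_component_ge.
move=> -[<-]; apply/esym;
  apply: etrans (prob_component_ge Pmarg Pdens i (0, 0) _) _.
by have [->|->] := ord2_cases i.
Qed.

(** At [(0, 0)] the union has probability [alpha], strictly more than [X_i > a_i] alone, while
    [X_i > b_i] has exactly [alpha]; tails decrease in the threshold. *)
Lemma second_lt_first i : component i b < component i a.
Proof.
rewrite -(ltr_tail Pdens i 0) tail_second_thresholds.
rewrite -[X in tail i X](_ : component i (0, 0) = 0); last first.
  by have [->|->] := ord2_cases i.
rewrite -prob_component_gt// -(prob_exceeds_some aP) -subr_gt0.
have mi := measurable_component_gt i (component i a).
have ma := measurable_exceeds_some a.
rewrite -probD//; last by rewrite exceeds_someE => x /= ax; exists i.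
(* The rectangle from [z] to [w] has [x_i <= a_i] and lies in the union through the other
   coordinate. *)
pose z := pair_of i (component i a - 1) (component (other i) a).
pose w := pair_of i (component i a) (component (other i) a + 1).
have zw j : component j z < component j w.
  move: j; apply: (@forall_ord2 i);
    by rewrite ?component_pair_of ?component_other_pair_of ?gtrBl ?ltrDl.
apply: lt_le_trans (density_rectangle Pdens (0, 0) (zw ord0) (zw ord_max)) _.
apply: prob_le; [exact: measurable_rectangle|exact: measurableD|].
move=> x [/=]; rewrite !in_itv/= /z /w exceeds_someE.
have [->|->] := ord2_cases i => /andP[zx1 xw1] /andP[zx2 xw2].
- by split; [exists ord_max|rewrite /component/= ltNge xw1].
- by split; [exists ord0|rewrite /component/= ltNge xw2].
Qed.

Let D0 := stepdown_rule a b.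

Lemma stepdown_rule_measurable : measurable_rule D0.
Proof.
move=> i; rewrite (_ : rejects _ _ = [set x | component i a < component i x] `|`
  ([set x | component i b <= component i x] `&`
   [set x | component (other i) a < component (other i) x])).
  apply: measurableU; first exact: measurable_component_gt.
  by apply: measurableI;
    [exact: measurable_component_ge|exact: measurable_component_gt].
apply/seteqP; split=> x; rewrite /rejects/= in_stepdown_rule.
  by move=> /orP[|/andP[]]; [left|right].
by move=> [->//|[-> ->]]; rewrite orbT.
Qed.

(** If only [H_i] is true, rejecting it needs [b_i <= X_i], which has probability at most [alpha]
    for [theta_i <= 0]. If both are true, any rejection lies in [exceeds_some a], an increasing
    event of probability [alpha] at [(0, 0)]. *)
Lemma stepdown_rule_FWER : FWER_le P alpha D0.
Proof.
move=> theta; have mD := measurable_rejects_in (true_hyp theta)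
  stepdown_rule_measurable.
rewrite probE// lee_fin.
have [[i it ijt]|none] := pselect (exists2 i, true_hyp theta i & ~ true_hyp
  theta (other i)).
  rewrite -(tail_second_thresholds i).
  apply: le_trans (tail_le Pmono i _ it).
  rewrite -prob_component_ge//; apply: prob_le => //;
    first exact: measurable_component_ge.
  move=> x [j jt]; have -> : j = i.
    apply: contrapT => ji; apply: ijt; suff <- : j = other i by [].
    by move: ji; have [->|->] := ord2_cases i; have [->|->] := ord2_cases j.
  rewrite in_stepdown_rule => /orP[ax|/andP[]//].
  exact: ltW (lt_trans (second_lt_first i) ax).
have [[i it]|none'] := pselect (exists i, true_hyp theta i); last first.
  rewrite (_ : [set x | _] = set0); last first.
    by apply/seteqP; split=> // x [i it]; case: none'; exists i.
  (* [alpha] is nonnegative, being a probability. *)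
  by rewrite /prob measure0 -(prob_exceeds_some aP) prob_ge0.
have all_true : forall j, component j theta <= component j ((0, 0) : R * R).
  apply: (@forall_ord2 i).
    by move: it; rewrite /true_hyp; have [->|->] := ord2_cases i.
  have : true_hyp theta (other i) by apply: contrapT => h; apply: none;
    exists i.
  by rewrite /true_hyp; have [->|->] := ord2_cases i.
rewrite -(prob_exceeds_some aP).
apply: le_trans (prob_monotone Pmono (measurable_exceeds_some a)
  (@exceeds_some_increasing _ a) all_true).
apply: prob_le => //; first exact: measurable_exceeds_some.
move=> x [j _ jD].
by rewrite -(stepdown_rule_any a b); apply/reject_anyP; exists j.
Qed.

Lemma stepdown_rule_C : ruleC P alpha D0.
Proof.
split; [exact: stepdown_rule_measurable|exact: stepdown_rule_monotone|].
exact: stepdown_rule_FWER.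
Qed.

(* Monotonicity makes [D] reject on the quadrant above [x], and the FWER bound
   at theta_i = 0 survives as the other parameter tends to +oo. *)
Lemma reject_both_ge D x i : ruleC P alpha D -> region D true true x ->
  component i b <= component i x.
Proof.
move=> [mD monD fwerD] [x0 x1].
have Dx j : j \in D x by have [->|->] := ord2_cases j.
rewrite leNgt -(ltr_tail Pdens i 0) tail_second_thresholds -leNgt.
apply/ler_addgt0Pr => e e0.
have [u eu] : exists u, 1 - e < tail (other i) u (component (other i) x).
  have /cvgr_gt/(_ (1 - e)) :=
    @tail_cvgy _ _ Pdiv (other i) (component (other i) x).
  rewrite gtrBl => /(_ e0) h.
  by near (+oo%R : set_system R) => u; exists u; near: u.
pose theta := pair_of i 0 u.
have mi := measurable_component_ge i (component i x).
have mo := measurable_component_ge (other i) (component (other i) x).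
(* As the union has probability at most 1, the intersection has more than [tail i 0 x_i - e]. *)
have := probUI (P theta) mi mo.
rewrite !prob_component_ge// component_pair_of component_other_pair_of => UI.
have U1 : prob (P theta) ([set y | component i x <= component i y] `|`
    [set y | component (other i) x <= component (other i) y]) <= 1.
  by rewrite -(prob_setT (P theta)) prob_le//; exact: measurableU.
have := fwerD theta; rewrite probE; last exact: measurable_rejects_in.
rewrite lee_fin; apply: contraLR; rewrite -!ltNge => lt_alpha.
suff : prob (P theta) ([set y | component i x <= component i y] `&`
    [set y | component (other i) x <= component (other i) y]) <=
    prob (P theta) [set y | exists2 i, true_hyp theta i & i \in D y] by lra.
apply: prob_le; [exact: measurableI|exact: measurable_rejects_in|].
move=> y [xi xo]; exists i; first by rewrite /true_hyp component_pair_of.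
rewrite (monD x y)// => j; last by rewrite Dx.
by move=> _; move: j; exact: (@forall_ord2 i).
Unshelve. all: by end_near. Qed.

(** The regions themselves are nested, so the power is compared at every [theta] and not just in the
    infimum. *)
Lemma reject_both_sub D : ruleC P alpha D -> rejects_any_iff_exceeds a D ->
  region D true true `<=` region D0 true true.
Proof.
move=> CD DE x Dx; apply/stepdown_rule_both; first exact: second_lt_first.
split=> [i|]; first exact: (reject_both_ge _ CD).
by rewrite -DE; apply/reject_anyP; exists ord0; case: Dx.
Qed.

(** Where both hypotheses are rejected, the downward clause of monotonicity is vacuous. *)
Lemma reject_both_up D x y : monotone_rule D -> region D true true x ->
  (forall i, component i x <= component i y) -> region D true true y.
Proof.
move=> monD [x0 x1] xy.
have Dx j : j \in D x by have [->|->] := ord2_cases j.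
by rewrite /region/= (monD x y)// => j; rewrite Dx.
Qed.

(** Open counterpart of [region D0 true true], from which it differs only on the lines [x_i = b_i];
    as a union of two quadrants that meet in a third, it inherits their convergence. *)
Let M : set (R * R) := quadrant (a.1, b.2) `|` quadrant (b.1, a.2).

Let mM : measurable M.
Proof. by apply: measurableU; exact: measurable_quadrant. Qed.

Lemma prob_M theta : prob (P theta) M =
  prob (P theta) (quadrant (a.1, b.2)) + prob (P theta) (quadrant (b.1, a.2)) -
  prob (P theta) (quadrant a).
Proof.
have mq := @measurable_quadrant R.
rewrite -(probUI (P theta) (mq (a.1, b.2)) (mq (b.1, a.2))).
rewrite (_ : _ `&` _ = quadrant a) ?addrK//.
have ba1 := second_lt_first ord0; have ba2 := second_lt_first ord_max.
apply/seteqP; split=> x; first by move=> [[? _] [_ ?]].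
by move=> [? ?]; split; split=> //=;
  [exact: lt_trans ba2 _|exact: lt_trans ba1 _].
Qed.

Lemma prob_M_eps_right :
  prob (P theta) M @[theta --> eps_right] --> prob (P eps) M.
Proof.
under eq_fun do rewrite prob_M.
rewrite prob_M.
by apply: cvgB; [apply: cvgD|]; exact: prob_quadrant_eps_right.
Qed.

Lemma prob_stepdown_both theta :
  prob (P theta) (region D0 true true) = prob (P theta) M.
Proof.
have ba := second_lt_first.
have mb i := measurable_component_eq i (component i b).
have mL := measurableU _ _ (mb ord0) (mb ord_max).
have md := measurable_reject_both stepdown_rule_measurable.
apply/eqP; rewrite eq_le; apply/andP; split.
- apply: (@le_trans _ _ (prob (P theta) (M `|` ([set x | component ord0 x
    = component ord0 b] `|`
      [set x | component ord_max x = component ord_max b])))).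
    apply: prob_le; rewrite //; first exact: measurableU.
    move=> x /(stepdown_rule_both ba)[bx ax].
    have [bx0|bx0] := eqVneq (component ord0 x) (component ord0 b);
      first by right; left.
    have [bx1|bx1] := eqVneq (component ord_max x) (component ord_max b);
      first by right; right.
    have lt0 : b.1 < x.1 by have := bx ord0;
      rewrite le_eqVlt eq_sym (negbTE bx0).
    have lt1 : b.2 < x.2 by have := bx ord_max;
      rewrite le_eqVlt eq_sym (negbTE bx1).
    by left; case: ax => ax; [left|right].
  apply: le_trans (probU_le _ mM mL) _; rewrite gerDl.
  apply: le_trans (probU_le _ (mb _) (mb _)) _.
  by rewrite /prob !density_line//= addr0.
- apply: prob_le => // x Mx; apply/(stepdown_rule_both ba).
  have ba0 := ba ord0; have ba1 := ba ord_max; rewrite /component/= in ba0 ba1.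
  split; last by case: Mx => -[]; [left|right].
  by case: Mx => -[/= h1 h2]; apply: (@forall_ord2 ord0); rewrite /component/=;
    apply: ltW => //; [exact: lt_trans h1|exact: lt_trans h2].
Qed.

Lemma stepdown_both_increasing : monotone_increasing (region D0 true true).
Proof.
by move=> x y Dx xy;
  exact: reject_both_up (@stepdown_rule_monotone _ a b) Dx xy.
Qed.

(** The region is increasing, so on [A2 eps] its probability is at least that at [eps]; letting
    [theta] decrease to [eps] gives the reverse. *)
Lemma inf_reject_both_stepdown :
  inf_reject_both P eps D0 = (prob (P eps) M)%:E.
Proof.
have md := measurable_reject_both stepdown_rule_measurable.
apply/eqP; rewrite eq_le; apply/andP; split.
- apply: bound_over_A2 prob_M_eps_right _ => theta A2t.
  by rewrite -prob_stepdown_both -probE//; apply: ereal_inf_lbound;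
    exists theta.
- apply: le_ereal_inf_tmp => _ [theta [/= /ltW t1 /ltW t2] <-].
  rewrite probE// lee_fin -prob_stepdown_both.
  apply: (prob_monotone Pmono md stepdown_both_increasing).
  exact: (@forall_ord2 ord0).
Qed.

Lemma inf_reject_both_le D : ruleC P alpha D -> rejects_any_iff_exceeds a D ->
  (inf_reject_both P eps D <= inf_reject_both P eps D0)%E.
Proof.
move=> CD DE; apply: le_ereal_inf_tmp => _ [theta A2t <-].
apply: le_trans (ereal_inf_lbound _) _; first by exists theta.
have [mD _ _] := CD; apply: le_measure; rewrite ?inE;
  last exact: reject_both_sub.
- exact: measurable_reject_both.
- exact: measurable_reject_both stepdown_rule_measurable.
Qed.

(* If [D] does not reject both at [x], it does not on the quadrant below [x],
   which meets [region D0 true true] in a set containing a rectangle. *)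
Lemma optimal_reject_both D x : ruleC P alpha D -> rejects_any_iff_exceeds a D
  ->
  (inf_reject_both P eps D0 <= inf_reject_both P eps D)%E ->
  (forall i, component i x != component i b) ->
  region D0 true true x -> region D true true x.
Proof.
move=> CD DE D0D xb /(stepdown_rule_both second_lt_first)[bx ax].
have ba := second_lt_first; have [mD monD _] := CD.
have {xb} bx i : component i b < component i x.
  by rewrite lt_neqAle eq_sym xb bx.
move: ax; rewrite exceeds_someE => -[i aix].
apply: contrapT => nDx; move: D0D;
  rewrite inf_reject_both_stepdown leNgt => /negP; apply.
(* Strictly above [z], coordinate [i] exceeds [a_i] and the other exceeds its second threshold. The
   strict [bx] keeps the rectangle from [z] to [x] nondegenerate. *)
pose z := pair_of i (component i a) (component (other i) b).
have zi : component i z = component i a by exact: component_pair_of.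
have zo : component (other i) z = component (other i) b by
  exact: component_other_pair_of.
have zx j : component j z < component j x.
  by move: j; apply: (@forall_ord2 i); [rewrite zi|rewrite zo; exact: bx].
have rectP y : rectangle z x y -> forall j, component j z < component j y
  <= component j x.
  by move=> [/=]; rewrite !in_itv/= => h1 h2; exact: (@forall_ord2 ord0).
have m0 := measurable_reject_both stepdown_rule_measurable.
have mR := measurable_rectangle z x.
have mDb := measurable_reject_both mD.
have R0 : rectangle z x `<=` region D0 true true.
  move=> y /rectP zyx; apply/(stepdown_rule_both ba).
  have /andP[zyi _] := zyx i; have /andP[zyo _] := zyx (other i).
  rewrite zi in zyi; rewrite zo in zyo.
  split; last by rewrite exceeds_someE; exists i.
  by apply: (@forall_ord2 i); apply: ltW => //; exact: lt_trans zyi.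
have DR : region D true true `<=` region D0 true true `\` rectangle z x.
  move=> y Dy; split; first exact: (reject_both_sub CD DE).
  move=> /rectP zyx; apply: nDx; apply: reject_both_up monD Dy _ => j.
  by have /andP[] := zyx j.
have zx1 : z.1 <= x.1 by exact: ltW (zx ord0).
have zx2 : z.2 <= x.2 by exact: ltW (zx ord_max).
(* At every [theta] the whole rectangle is lost, and its probability converges to a positive value
   at [eps], so the loss survives in the infimum. *)
have le_inf : (inf_reject_both P eps D <=
    (prob (P eps) M - prob (P eps) (rectangle z x))%:E)%E.
  apply: (@bound_over_A2 _
    (fun theta => prob (P theta) M - prob (P theta) (rectangle z x))).
    under [X in X @ _ --> _]eq_fun do rewrite prob_rectangle//.
    rewrite prob_rectangle//; apply: cvgB; first exact: prob_M_eps_right.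
    apply: cvgB; first exact: prob_quadrant_eps_right.
    by apply: cvgB; [apply: cvgD|]; exact: prob_quadrant_eps_right.
  move=> theta A2t; rewrite -prob_stepdown_both -probD//.
  apply: le_trans (ereal_inf_lbound _) _; first by exists theta.
  by rewrite probE// lee_fin prob_le//; exact: measurableD.
apply: le_lt_trans le_inf _; rewrite lte_fin ltrBlDr ltrDl.
by apply: density_rectangle => //; [exact: (zx ord0)|exact: (zx ord_max)].
Qed.

(** If [H_i] were kept at [x], the other hypothesis would be rejected, and lowering [x_i] to [a_i]
    would not change [D]; but the lowered point exceeds no threshold. *)
Lemma rejects_sole_exceeding D x i : monotone_rule D ->
  rejects_any_iff_exceeds a D ->
  component i a < component i x ->
  component (other i) x <= component (other i) a -> i \in D x.
Proof.
move=> monD DE aix xao; apply: contrapT => /negP niD.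
have exD y : exceeds_some a y <-> exists j, j \in D y.
  by rewrite -DE; exact: reject_anyP.
have oD : other i \in D x.
  have /exD[j jD] : exceeds_some a x by rewrite exceeds_someE; exists i.
  by move: j jD; apply: (@forall_ord2 i) => // iD; rewrite iD in niD.
pose y := pair_of i (component i a) (component (other i) x).
have yi : component i y = component i a by exact: component_pair_of.
have yo : component (other i) y = component (other i) x by
  exact: component_other_pair_of.
have DyE : D y = D x.
  apply: monD; apply: (@forall_ord2 i); rewrite ?yi ?yo//.
    by move=> iD; rewrite iD in niD.
  by rewrite oD.
have /exD : exists j, j \in D y by exists (other i); rewrite DyE.
rewrite exceeds_someE => -[j]; move: j; apply: (@forall_ord2 i).
  by rewrite yi ltxx.
by rewrite yo ltNge xao.
Qed.

(** Off the null lines [x_i = b_i] there are three cases: no threshold in [a] is exceeded and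
    neither rule rejects; [D0] rejects both, and so does [D] by optimality; or one coordinate alone
    exceeds its threshold and both rules reject just that hypothesis. *)
Lemma optimal_stepdown_unique D :
  maximizes (ruleC P alpha `&` rejects_any_iff_exceeds a)
    (inf_reject_both P eps) D ->
  {ae (lebesgue_measure \x lebesgue_measure)%E, forall x, D x = D0 x}.
Proof.
have ba := second_lt_first.
have E0 := stepdown_rule_any a b.
move=> [[CD DE] /(_ D0 (conj stepdown_rule_C E0)) D0D].
have [mD monD _] := CD.
exists ([set x | component ord0 x = component ord0 b] `|`
        [set x | component ord_max x = component ord_max b]); split.
- by apply: measurableU; exact: measurable_component_eq.
- rewrite measureU0;
    [exact: (lebesgue_line ord0)| | |exact: (lebesgue_line ord_max)].
    exact: (measurable_component_eq ord0 (component ord0 b)).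
  exact: (measurable_component_eq ord_max (component ord_max b)).
move=> x /= neq; apply: contrapT => /not_orP[xb0 xb1]; apply: neq.
have xb : forall i, component i x != component i b.
  by apply: (@forall_ord2 ord0); apply/eqP.
have [nx|ex] := pselect (~ exceeds_some a x).
  have no_reject D' : rejects_any_iff_exceeds a D' -> forall j, (j \in D' x)
    = false.
    move=> D'E j; apply/negP => jD'; apply: nx.
    by rewrite -D'E; apply/reject_anyP; exists j.
  by apply/setP => j; rewrite !no_reject.
have bothP D' : region D' true true x <-> forall i, i \in D' x.
  split=> [[h0 h1]|h]; first exact: (@forall_ord2 ord0).
  by split; exact: h.
have [d0|nd0] := pselect (region D0 true true x).
  have /bothP d := optimal_reject_both CD DE D0D xb d0.
  by move/bothP: d0 => d0; apply/setP => j; rewrite d d0.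
have nd : ~ region D true true x by move=> /(reject_both_sub CD DE).
move: ex => /contrapT; rewrite exceeds_someE => -[i aix].
have xao : component (other i) x <= component (other i) a.
  rewrite leNgt; apply/negP => axo; apply: nd0; apply/bothP.
  apply: (@forall_ord2 i); rewrite in_stepdown_rule ?aix//.
  by rewrite axo.
have sole D' : monotone_rule D' -> rejects_any_iff_exceeds a D' ->
    ~ region D' true true x -> i \in D' x /\ (other i \in D' x) = false.
  move=> monD' D'E nD'; have iD' := rejects_sole_exceeding monD' D'E aix xao.
  split=> //; apply/negP => oD'; apply: nD'; apply/bothP.
  exact: (@forall_ord2 i).
have [i1 o1] := sole D monD DE nd.
have [i0 o0] := sole D0 (@stepdown_rule_monotone _ a b) E0 nd0.
by apply/setP; apply: (@forall_ord2 i); rewrite ?i1 ?o1 ?i0 ?o0.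
Qed.

End BothRejected.

Theorem theorem2p1 (R : realType) (P : R * R -> probability (R * R)%type R)
  (alpha : R) (eps : R * R)
  (Pmarg : marginals_depend_on_own P)
  (Pdiv : marginals_diverge P)
  (Pdens : positive_densities P)
  (Pmono : monotone_family P)
  (alpha01 : 0 < alpha < 1)
  (eps_gt0 : 0 < eps.1 /\ 0 < eps.2)
  (Prc : marginals_right_continuous_at P eps) :
  (exists a, first_thresholds P alpha eps a) /\
  (exists b, second_thresholds P alpha b) /\
  forall a b : R * R,
  first_thresholds P alpha eps a -> second_thresholds P alpha b ->
  [/\ (* (i) *)
      forall D, ruleC P alpha D -> rejects_any_iff_exceeds a D ->
        (forall i, [set x | component i a < component i x] `<=` rejects D i) ->
        maximizes (ruleC P alpha) (inf_reject_any P eps) D /\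
        inf_reject_any P eps D = marginal P ord0 eps.1 [set u | a.1 < u],
      (* (ii) *)
      (b.1 < a.1 /\ b.2 < a.2) /\
      exists D, [/\ stepdown a b D,
        maximizes (ruleC P alpha `&` rejects_any_iff_exceeds a)
                  (inf_reject_both P eps) D,
        inf_reject_both P eps D =
          P eps ([set x | a.1 < x.1 /\ b.2 < x.2] `|`
                 [set x | b.1 < x.1 /\ a.2 < x.2])
        & forall D',
            maximizes (ruleC P alpha `&` rejects_any_iff_exceeds a)
                      (inf_reject_both P eps) D' ->
            {ae (lebesgue_measure \x lebesgue_measure)%E,
              forall x, D' x = D x}]
    & (* (iii) *)
      forall D, ruleC P alpha D -> rejects_any_iff_exceeds a D ->
        (forall i, [set x | component i a < component i x] `<=` rejects D i) ->
        [/\ maximizes (ruleC P alpha) (inf_reject_false P eps) D,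
            inf_reject_false P eps D = marginal P ord0 eps.1 [set u | a.1 < u]
          & inf_reject_false P eps D =
            marginal P ord_max eps.2 [set u | a.2 < u]]].
Proof.
split; first exact: first_thresholds_exist.
split; first exact: second_thresholds_exist.
move=> a b aP bP.
(* Claims (i) and (iii) share this scheme: an upper bound over the class, attained by [D]. *)
have maxC D (crit : rule -> \bar R) : ruleC P alpha D ->
    crit D = (@tail R P ord0 eps.1 a.1)%:E ->
    (forall D', ruleC P alpha D' -> (crit D' <= (@tail R P ord0 eps.1
      a.1)%:E)%E) ->
    maximizes (ruleC P alpha) crit D.
  by move=> CD DE le_crit; split=> // D' CD'; rewrite DE; exact: le_crit.
have any_le := inf_reject_any_le Pmarg Pdiv Pdens Prc aP.
split.
- move=> D CD _ aD.
  have [anyE _] := optimal_reject_any Pmarg Pdiv Pdens Pmono Prc aP eps_gt0 CD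
    aD.
  by rewrite marginalE; split=> //; exact: maxC.
- have ba := second_lt_first Pmarg Pdens aP bP.
  split; first by split; [exact: (ba ord0)|exact: (ba ord_max)].
  exists (stepdown_rule a b); split.
  + exact: stepdown_ruleP.
  + split; last by move=> D' [CD' D'E];
      exact: (inf_reject_both_le Pmarg Pdiv Pdens aP bP CD' D'E).
    by split; [exact: (stepdown_rule_C Pmarg Pdens Pmono aP bP)|
      exact: stepdown_rule_any].
  + rewrite (inf_reject_both_stepdown Pmarg Pdens Pmono Prc aP bP) -probE//.
    by apply: measurableU; exact: measurable_quadrant.
  + by move=> D'; exact: (optimal_stepdown_unique Pmarg Pdiv Pdens Pmono Prc aP
      bP).
- move=> D CD _ aD.
  have [_ falseE] := optimal_reject_any Pmarg Pdiv Pdens Pmono Prc aP eps_gt0 CD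
    aD.
  split.
  + apply: maxC => // D' CD'; have [mD' _ _] := CD'.
    apply: le_trans (any_le _ CD').
    exact: inf_reject_false_le_any.
  + by rewrite marginalE.
  + by rewrite marginalE falseE (tail_thresholds aP ord_max).
Qed.
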